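(* Let $r\ge 2$, let $H\in\mathbb R^{p\times q}$, and let $X\subset\mathbb R^p$, $Y\subset\mathbb R^q$, $F$, $G$, $\psi$, $\phi$ satisfy Assumptions A and B (stated in the context). Let $(x(t),u(t),y(t),v(t))$ be a trajectory of the dynamics (D) of the context, and let $(x^\star,u^\star,y^\star,v^\star)$ be an equilibrium point of (D), where $(x^\star,y^\star)$ is the saddle point of $\min_{x\in X}\max_{y\in Y}L(x,y)$, $L(x,y)=F(x)+x^{\rm T}Hy-G(y)$. Then: (i) the duality gap $L(x(t),y^\star)-L(x^\star,y(t))$ converges to $0$ with a rate of $\mathcal O(1/t^2)$; (ii) $(x(t),y(t))$ converges to $(x^\star,y^\star)$ as $t\to\infty$.
   Context: A pair $(x^\star,y^\star)\in X\times Y$ is a saddle point if $L(x^\star,y)\le L(x^\star,y^\star)\le L(x,y^\star)$ for all $x\in X$, $y\in Y$. Assumption A: $X\subset\mathbb R^p$ and $Y\subset\mathbb R^q$ are nonempty, closed and convex; $F$ and $G$ are continuously differentiable and strictly convex on open sets containing $X$ and $Y$, respectively; $\nabla F$ and $\nabla G$ are Lipschitz continuous over $X$ and $Y$, respectively; there exists a unique saddle point of the problem. Assumption B: $\psi:\mathbb R^p\to\mathbb R\cup\{\infty\}$ and $\phi:\mathbb R^q\to\mathbb R\cup\{\infty\}$ are proper, closed, strongly convex functions with ${\rm dom}(\psi)=X$ and ${\rm dom}(\phi)=Y$, where ${\rm dom}(\psi)=\{x:\psi(x)<\infty\}$; they are continuously differentiable with Lipschitz continuous gradients on their domains (i.e.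 on $X$, $\psi$ coincides with a function that is continuously differentiable on an open set containing $X$, whose gradient on $X$ is denoted $\nabla\psi$ and is Lipschitz on $X$; likewise for $\phi$ on $Y$); and $\nabla\psi^*$, $\nabla\phi^*$ are Lipschitz continuous. Here $\psi^*(u)=\sup_x\{x^{\rm T}u-\psi(x)\}$ is the convex conjugate, which is differentiable with $\nabla\psi^*(u)={\rm argmin}_{x\in X}\{-x^{\rm T}u+\psi(x)\}$ (similarly for $\phi^*$). Dynamics (D): $$\dot x=\tfrac rt[\nabla\psi^*(u)-x],\qquad \dot y=\tfrac rt[\nabla\phi^*(v)-y],$$ $$\dot u=\tfrac tr\big[-\nabla F(x)-H(y+\tfrac tr\dot y)+\nabla\psi(x+\tfrac tr\dot x)-u\big],$$ $$\dot v=\tfrac tr\big[-\nabla G(y)+H^{\rm T}(x+\tfrac tr\dot x)+\nabla\phi(y+\tfrac tr\dot y)-v\big],$$ with $x(0)=x_0=\nabla\psi^*(u_0)$, $u(0)=u_0=\nabla\psi(x_0)$, $y(0)=y_0=\nabla\phi^*(v_0)$, $v(0)=v_0=\nabla\phi(y_0)$. A trajectory is a quadruple of functions continuous on $[0,\infty)$ and differentiable on $(0,\infty)$, satisfying the differential equations for $t>0$ and the initial conditions at $t=0$. Equilibrium point of (D): a constant quadruple at which all brackets vanish with $\dot x=0,\dot y=0$, i.e. $x^\star=\nabla\psi^*(u^\star)$, $y^\star=\nabla\phi^*(v^\star)$, $-\nabla F(x^\star)-Hy^\star+\nabla\psi(x^\star)-u^\star=0$, $-\nabla G(y^\star)+H^{\rm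 T}x^\star+\nabla\phi(y^\star)-v^\star=0$. A nonnegative quantity $g(t)$ converges to $0$ with rate $\mathcal O(1/t^2)$ if there is a constant $C$ (independent of $t$) with $g(t)\le C/t^2$ for all $t>0$. *)

(* Defs.v *)
From HB Require Import structures.
From mathcomp Require Import all_boot all_order all_algebra.
From mathcomp Require Import all_classical all_reals all_analysis.

Set Implicit Arguments.
Unset Strict Implicit.
Unset Printing Implicit Defensive.

Import Order.TTheory GRing.Theory Num.Theory.
Import numFieldNormedType.Exports.

Local Open Scope classical_set_scope.
Local Open Scope ring_scope.

(* Vectors of R^n are columns 'cV[R]_n.  Their library norm is the sup norm;
   limits, differentiability and the existence of a Lipschitz constant are the
   same as for the Euclidean norm, which is used in strong convexity. *)
Definition dot (R : realType) (n : nat) (x y : 'cV[R]_n) : R :=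
  (x^T *m y) 0 0.

Definition grad (R : realType) (n : nat) (f : 'cV[R]_n -> R) (x : 'cV[R]_n) :
    'cV[R]_n :=
  \col_i 'D_(delta_mx i 0) f x.

Definition C1_on (R : realType) (n : nat) (U : set 'cV[R]_n)
    (f : 'cV[R]_n -> R) : Prop :=
  forall x, U x -> differentiable f x /\ {for x, continuous (grad f)}.

Definition strictly_convex_on (R : realType) (n : nat) (U : set 'cV[R]_n)
    (f : 'cV[R]_n -> R) : Prop :=
  convex_set (U : set (convex_lmodType 'cV[R]_n)) /\
  forall (x y : 'cV[R]_n) (a : R), U x -> U y -> x != y -> 0 < a < 1 ->
    f (a *: x + (1 - a) *: y) < a * f x + (1 - a) * f y.

Definition saddle_point (T1 T2 : Type) (R : realType) (X : set T1) (Y : set T2)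
    (L : T1 -> T2 -> R) (xs : T1) (ys : T2) : Prop :=
  [/\ X xs, Y ys &
      forall x y, X x -> Y y -> L xs y <= L xs ys <= L x ys].

Definition lagrangian (R : realType) (p q : nat) (F : 'cV[R]_p -> R)
    (G : 'cV[R]_q -> R) (H : 'M[R]_(p, q)) (x : 'cV[R]_p) (y : 'cV[R]_q) : R :=
  F x + dot x (H *m y) - G y.

Definition objective_assumption (R : realType) (n : nat) (X : set 'cV[R]_n)
    (F : 'cV[R]_n -> R) : Prop :=
  [/\ X !=set0, closed X, convex_set (X : set (convex_lmodType 'cV[R]_n)),
      exists U : set 'cV[R]_n,
        [/\ open U, X `<=` U, C1_on U F & strictly_convex_on U F] &
      [lipschitz (grad F x) | x in X]].

Definition assumption_A (R : realType) (p q : nat)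
    (X : set 'cV[R]_p) (Y : set 'cV[R]_q)
    (F : 'cV[R]_p -> R) (G : 'cV[R]_q -> R) (H : 'M[R]_(p, q)) : Prop :=
  [/\ objective_assumption X F, objective_assumption Y G &
      exists! z : 'cV[R]_p * 'cV[R]_q,
        saddle_point X Y (lagrangian F G H) z.1 z.2].

Definition dom (R : realType) (n : nat) (psi : 'cV[R]_n -> \bar R) :
    set 'cV[R]_n :=
  [set x | (psi x < +oo)%E].

Definition proper_fun (R : realType) (n : nat) (psi : 'cV[R]_n -> \bar R) :
    Prop :=
  (forall x, psi x != -oo%E) /\ dom psi !=set0.

Definition closed_fun (R : realType) (n : nat) (psi : 'cV[R]_n -> \bar R) :
    Prop :=
  closed [set z : 'cV[R]_n * R | (psi z.1 <= z.2%:E)%E].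

Definition strongly_convex (R : realType) (n : nat)
    (psi : 'cV[R]_n -> \bar R) : Prop :=
  exists2 mu : R, 0 < mu &
    forall (x y : 'cV[R]_n) (a : R), 0 < a < 1 ->
      (psi (a *: x + (1 - a) *: y)%R <=
       a%:E * psi x + (1 - a)%:E * psi y
       - (mu / 2 * a * (1 - a) * dot (x - y) (x - y))%:E)%E.

Definition conjugate (R : realType) (n : nat) (psi : 'cV[R]_n -> \bar R)
    (u : 'cV[R]_n) : \bar R :=
  ereal_sup (range (fun x => ((dot x u)%:E - psi x)%E)).

(* For proper, closed, strongly convex psi the conjugate is finite and
   differentiable everywhere, so neither `fine` nor `grad` takes a junk value. *)
Definition grad_conjugate (R : realType) (n : nat) (psi : 'cV[R]_n -> \bar R) :
    'cV[R]_n -> 'cV[R]_n :=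
  grad (fun u => fine (conjugate psi u)).

(* psiS is the C^1 function with which psi coincides on its domain X; the
   gradient of psi on X is the gradient of psiS.  When X has empty interior
   this depends on psiS, which is therefore part of the data. *)
Definition mirror_assumption (R : realType) (n : nat) (X : set 'cV[R]_n)
    (psi : 'cV[R]_n -> \bar R) (psiS : 'cV[R]_n -> R) : Prop :=
  [/\ [/\ proper_fun psi, closed_fun psi, strongly_convex psi & dom psi = X],
      forall x, X x -> psi x = (psiS x)%:E,
      exists U : set 'cV[R]_n, [/\ open U, X `<=` U & C1_on U psiS],
      [lipschitz (grad psiS x) | x in X] &
      lipschitz (grad_conjugate psi)].

Definition assumption_B (R : realType) (p q : nat)
    (X : set 'cV[R]_p) (Y : set 'cV[R]_q)
    (psi : 'cV[R]_p -> \bar R) (psiS : 'cV[R]_p -> R)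
    (phi : 'cV[R]_q -> \bar R) (phiS : 'cV[R]_q -> R) : Prop :=
  mirror_assumption X psi psiS /\ mirror_assumption Y phi phiS.

Definition regular_curve (R : realType) (n : nat) (x : R -> 'cV[R]_n) : Prop :=
  {within `[0, +oo[, continuous x} /\ (forall t : R, 0 < t -> derivable x t 1).

Record trajectory (R : realType) (p q : nat) (r : R) (H : 'M[R]_(p, q))
    (F : 'cV[R]_p -> R) (G : 'cV[R]_q -> R)
    (psi : 'cV[R]_p -> \bar R) (psiS : 'cV[R]_p -> R)
    (phi : 'cV[R]_q -> \bar R) (phiS : 'cV[R]_q -> R)
    (x u : R -> 'cV[R]_p) (y v : R -> 'cV[R]_q) : Prop := Trajectory {
  traj_regular :
    [/\ regular_curve x, regular_curve u, regular_curve y & regular_curve v];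
  traj_x : forall t : R, 0 < t ->
    derive1 x t = (r / t) *: (grad_conjugate psi (u t) - x t);
  traj_y : forall t : R, 0 < t ->
    derive1 y t = (r / t) *: (grad_conjugate phi (v t) - y t);
  traj_u : forall t : R, 0 < t ->
    derive1 u t = (t / r) *: (- grad F (x t) - H *m (y t + (t / r) *: derive1 y t)
                          + grad psiS (x t + (t / r) *: derive1 x t) - u t);
  traj_v : forall t : R, 0 < t ->
    derive1 v t = (t / r) *: (- grad G (y t) + H^T *m (x t + (t / r) *: derive1 x t)
                          + grad phiS (y t + (t / r) *: derive1 y t) - v t);
  traj_x0 : x 0 = grad_conjugate psi (u 0);
  traj_u0 : u 0 = grad psiS (x 0);
  traj_y0 : y 0 = grad_conjugate phi (v 0);
  traj_v0 : v 0 = grad phiS (y 0)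
}.

Record equilibrium (R : realType) (p q : nat) (H : 'M[R]_(p, q))
    (F : 'cV[R]_p -> R) (G : 'cV[R]_q -> R)
    (psi : 'cV[R]_p -> \bar R) (psiS : 'cV[R]_p -> R)
    (phi : 'cV[R]_q -> \bar R) (phiS : 'cV[R]_q -> R)
    (xs us : 'cV[R]_p) (ys vs : 'cV[R]_q) : Prop := Equilibrium {
  equil_x : xs = grad_conjugate psi us;
  equil_y : ys = grad_conjugate phi vs;
  equil_u : - grad F xs - H *m ys + grad psiS xs - us = 0;
  equil_v : - grad G ys + H^T *m xs + grad phiS ys - vs = 0
}.

Definition inverse_square_rate (R : realType) (g : R -> R) : Prop :=
  exists C : R, forall t : R, 0 < t -> 0 <= g t <= C / t ^+ 2.

(* Main.v *)
(* The energy is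
     V(t) = t^2 gap(t) + r^2 (psi^*(u) - <xs, u> + phi^*(v) - <ys, v>),
   where gap(t) = L(x, ys) - L(xs, y).  Up to a constant the bracket is the sum
   of the Bregman distances of psi^* and phi^* from us to u and from vs to v, so
   it is bounded below.  Its derivative involves z = grad psi^*(u) = x + (t/r) x'
   and w = grad phi^*(v) = y + (t/r) y'.  As z minimizes psi - <., u>, the term
   grad psi(z) - u contributes nonpositively, and likewise for w; with convexity
   of F and G and the cancellation of <z, H w> this leaves
   V' <= (2 - r) t gap <= 0, and V(t) <= V(0) is the rate.  For the convergence,
   a strictly convex function exceeds its minimum by a fixed amount outside any
   ball around the minimizer, so a vanishing gap forces x -> xs and y -> ys. *)
Require Import Defs.
From HB Require Import structures.
From mathcomp Require Import all_boot all_order all_algebra.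
From mathcomp Require Import all_classical all_reals all_analysis.
From mathcomp Require Import ring lra.

Set Implicit Arguments.
Unset Strict Implicit.
Unset Printing Implicit Defensive.

Import Order.TTheory GRing.Theory Num.Theory.
Import numFieldNormedType.Exports.

Local Open Scope classical_set_scope.
Local Open Scope ring_scope.

(** * The Euclidean inner product and its comparison with the sup norm *)

Section dot_product.
Variables (R : realType) (n : nat).
Implicit Types x y z : 'cV[R]_n.

Lemma dotE x y : dot x y = \sum_i x i 0 * y i 0.
Proof. by rewrite /dot mxE; apply: eq_bigr => i _; rewrite mxE. Qed.

Lemma dotC x y : dot x y = dot y x.
Proof. by rewrite !dotE; apply: eq_bigr => i _; rewrite mulrC. Qed.

Lemma dotDr x y z : dot x (y + z) = dot x y + dot x z.
Proof. by rewrite /dot mulmxDr mxE. Qed.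

Lemma dotZr a x y : dot x (a *: y) = a * dot x y.
Proof. by rewrite /dot -scalemxAr mxE. Qed.

Lemma dotNr x y : dot x (- y) = - dot x y.
Proof. by rewrite -scaleN1r dotZr mulN1r. Qed.

Lemma dotDl x y z : dot (x + y) z = dot x z + dot y z.
Proof. by rewrite dotC dotDr !(dotC z). Qed.

Lemma dotZl a x y : dot (a *: x) y = a * dot x y.
Proof. by rewrite dotC dotZr dotC. Qed.

Lemma dotNl x y : dot (- x) y = - dot x y.
Proof. by rewrite dotC dotNr dotC. Qed.

Lemma norm_coord x i : `|x i 0| <= `|x|.
Proof.
rewrite [leRHS]/Num.Def.normr/= mx_normrE.
exact: (le_bigmax _ (fun ij => `|x ij.1 ij.2|) (i, 0)).
Qed.

Lemma norm_dot_le x y : `|dot x y| <= n%:R * (`|x| * `|y|).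
Proof.
rewrite dotE (le_trans (ler_norm_sum _ _ _))//.
rewrite (@le_trans _ _ (\sum_(i < n) `|x| * `|y|))//.
  by apply: ler_sum => i _; rewrite normrM ler_pM// norm_coord.
by rewrite sumr_const card_ord mulr_natl.
Qed.

Lemma dot_ge0 x : 0 <= dot x x.
Proof. by rewrite dotE sumr_ge0// => i _; rewrite -expr2 sqr_ge0. Qed.

(** The sup norm is attained at some coordinate, whose square is one term of the sum of squares. *)
Lemma sqr_norm_le_dot x : `|x| ^+ 2 <= dot x x.
Proof.
have [->|x0] := eqVneq `|x| 0; first by rewrite expr0n dot_ge0.
have [[i j]/= xij] := mx_norm_neq0 x0.
rewrite (_ : `|x| = `|x i 0|); last by rewrite /Num.Def.normr/= xij ord1.
rewrite real_normK ?num_real// dotE (bigD1 i)//= -expr2 lerDl.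
by rewrite sumr_ge0// => k _; rewrite -expr2 sqr_ge0.
Qed.

Lemma dot_is_linear x : linear (dot x : 'cV[R]_n -> R^o).
Proof. by move=> a y z; rewrite dotDr dotZr. Qed.

HB.instance Definition _ x :=
  GRing.isLinear.Build R 'cV[R]_n R^o _ (dot x : 'cV[R]_n -> R^o)
    (dot_is_linear x).

Lemma dot_continuous x : continuous (dot x).
Proof.
apply: (@bounded_linear_continuous R 'cV[R]_n R^o (dot x : 'cV[R]_n -> R^o)).
apply/linear_boundedP; exists (n%:R * `|x|); split; first exact: num_real.
move=> M xM y; rewrite (le_trans (norm_dot_le x y))// mulrA.
by rewrite ler_wpM2r// ltW.
Qed.

Lemma differentiable_dot x y : differentiable (dot x) y.
Proof.
have := @linear_differentiable R 'cV[R]_n R^o (dot x : 'cV[R]_n -> R^o) y.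
by apply; exact: dot_continuous.
Qed.

End dot_product.

Lemma dot_mulmxr (R : realType) (m n : nat) (A : 'M[R]_(m, n)) x y :
  dot x (A *m y) = dot (A^T *m x) y.
Proof. by rewrite /dot trmx_mul trmxK mulmxA. Qed.

(** * Compactness in spaces of column vectors *)

Section column_topology.
Variables (R : realType) (n : nat).
Implicit Types (A : set 'cV[R]_n).

Lemma norm_trmx (m k : nat) (M : 'M[R]_(m, k)) : `|M^T| = `|M|.
Proof.
suff le (m' k' : nat) (N : 'M[R]_(m', k')) : `|N^T| <= `|N|.
  by apply/eqP; rewrite eq_le le -[M in `|M| <= _]trmxK le.
rewrite [leLHS]/Num.Def.normr/= mx_normrE; apply: bigmax_le => // -[i j] _ /=.
rewrite mxE [leRHS]/Num.Def.normr/= mx_normrE.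
exact: (le_bigmax _ (fun ij => `|N ij.1 ij.2|) (j, i)).
Qed.

Lemma trmx_continuous (m k : nat) :
  continuous (trmx : 'M[R]_(m, k) -> 'M[R]_(k, m)).
Proof.
apply: bounded_linear_continuous; apply/linear_boundedP.
exists 1; split; first exact: num_real.
by move=> M M1 x; rewrite norm_trmx -[leLHS]mul1r ler_wpM2r// ltW.
Qed.

(** Transposition is a sup-norm isometry, which carries Heine-Borel over from row vectors. *)
Lemma bounded_closed_compact_cV A : bounded_set A -> closed A -> compact A.
Proof.
move=> [M [Mr AM]] Acl.
rewrite (_ : A = trmx @` ((trmx : 'rV[R]_n -> 'cV[R]_n) @^-1` A)); last first.
  apply/seteqP; split=> [x Ax|_ [x Ax <-]//].
  by exists x^T; rewrite /= trmxK.
apply: continuous_compact.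
  exact: continuous_subspaceT (@trmx_continuous _ _).
apply: bounded_closed_compact.
  by exists M; split=> // k Mk x Ax; rewrite /= -norm_trmx; exact: AM.
by apply: preimage_closed => // x _; exact: trmx_continuous.
Qed.

End column_topology.

(** * One-sided directional derivatives and convexity *)

Lemma convex_setP (R : realType) (V : lmodType R) (A : set V) :
  convex_set (A : set (convex_lmodType V)) ->
  forall x y (a : R), A x -> A y -> 0 < a < 1 ->
    A (a *: x + (1 - a) *: y).
Proof.
move=> cA x y a Ax Ay /andP[a0 a1].
have a01 : 0 <= a <= 1 by rewrite !ltW.
have := cA x y (Itv01 (ltW a0) (ltW a1)); rewrite !inE => /(_ Ax Ay).
by [].
Qed.

Lemma derive_dot_grad (R : realType) (n : nat) (f : 'cV[R]_n -> R) x v :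
  differentiable f x -> 'D_v f x = dot (grad f x) v.
Proof.
move=> df; rewrite deriveE// [in LHS](matrix_sum_delta v).
rewrite linear_sum dotE; apply: eq_bigr => i _.
by rewrite big_ord1 linearZ mxE deriveE// mulrC.
Qed.

(** An existing two-sided limit of difference quotients equals the limit from the right, so steps
    [h > 0] suffice. This matters where only one direction stays inside a convex set or a time
    interval. *)
Lemma derive_right_le (R : realType) (V : normedModType R) (f : V -> R) x v
    (c : R) :
  derivable f x v ->
  (forall e : R, 0 < e ->
    \forall h \near 0^'+, f (h *: v + x) <= f x + h * (c + e)) ->
  'D_v f x <= c.
Proof.
move=> dfx fle; apply/ler_addgt0Pr => e e0.
have ce := cvg_at_rightE
  (fun h : R => h^-1 *: ((f \o shift x) (h *: v) - f x)) 0 dfx.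
rewrite /derive ce; apply: limr_le.
  by apply/cvg_ex; exists ('D_v f x); exact: cvg_dnbhs_at_right.
near=> h; have h0 : 0 < h by [].
rewrite /= -ler_pdivlMl ?invr_gt0// invrK lerBlDl.
by near: h; exact: fle.
Unshelve. all: by end_near. Qed.

(** The term [a * k] vanishes to first order. The case [k = 0] covers plain convexity and optimality
    conditions; a nonzero [k] absorbs the quadratic remainder of strong convexity. *)
Lemma convex_derive_le (R : realType) (n : nat) (f : 'cV[R]_n -> R) x y
    (c k : R) :
  differentiable f y ->
  (forall a : R, 0 < a < 1 ->
    f (a *: x + (1 - a) *: y) <= f y + a * (c + a * k)) ->
  dot (grad f y) (x - y) <= c.
Proof.
move=> df fle; rewrite -derive_dot_grad//.
apply: derive_right_le; first exact: diff_derivable.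
move=> e e0; near=> h.
have h0 : 0 < h by [].
have -> : h *: (x - y) + y = h *: x + (1 - h) *: y.
  by rewrite scalerBr scalerBl scale1r addrAC addrA.
rewrite (le_trans (fle h _))// ?h0//.
  near: h; exact: nbhs_right_lt.
rewrite lerD2l ler_pM2l// lerD2l (le_trans (ler_norm _))//.
rewrite normrM (gtr0_norm h0).
have k1 : 0 < `|k| + 1 by rewrite ltr_wpDl.
rewrite (@le_trans _ _ (h * (`|k| + 1)))// ?ler_wpM2l ?ltW ?ltrDl//.
rewrite -ltr_pdivlMr//; near: h; apply: nbhs_right_lt; exact: divr_gt0.
Unshelve. all: by end_near. Qed.

Lemma continuous_scaled_translation (R : realType) (V : normedModType R)
  (k : R) (c : V) : continuous (fun a => k *: (a - c)).
Proof.
move=> a; apply: cvgZ; first exact: cvg_cst.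
by apply: cvgB; [exact: cvg_id|exact: cvg_cst].
Qed.

(** * Differentiability from a continuous choice of subgradients *)

Section subgradient.
Variables (R : realType) (n : nat).
Variables (f : 'cV[R]_n -> R) (z : 'cV[R]_n -> 'cV[R]_n).
Hypothesis fz : forall a b, f a + dot (z a) (b - a) <= f b.

(** The subgradient inequalities at [a] and at [h + a] squeeze the increment of [f] between
    [dot (z a) h] and [dot (z (h + a)) h]; continuity of [z] makes the difference of these bounds a
    little-o of [h]. *)
Let diff_subgradient a : continuous z ->
  differentiable f a /\ 'd f a = dot (z a) :> ('cV[R]_n -> R).
Proof.
move=> cz.
have fE : (f : 'cV[R]_n -> R^o) \o shift a =
    cst (f a) + (dot (z a) : 'cV[R]_n -> R^o) +o_ 0 id.
  apply/eqaddoP => e e0; near=> h.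
  rewrite /= !fctE /=.
  have lo : f a + dot (z a) h <= f (h + a).
    by have := fz a (h + a); rewrite addrK.
  have up : f (h + a) <= f a + dot (z (h + a)) h.
    have := fz (h + a) a; rewrite (_ : a - (h + a) = - h) ?dotNr ?lerBlDr//.
    by rewrite opprD addrCA subrr addr0.
  rewrite ger0_norm ?subr_ge0//.
  rewrite (@le_trans _ _ (dot (z (h + a) - z a) h))//.
    by rewrite dotDl dotNl; lra.
  rewrite (le_trans (ler_norm _))// (le_trans (norm_dot_le _ _))//.
  rewrite mulrA ler_wpM2r//.
  rewrite (@le_trans _ _ ((n%:R + 1) * `|z (h + a) - z a|))//.
    by rewrite ler_wpM2r// lerDl.
  rewrite -ler_pdivlMl ?ltr_wpDl// distrC mulrC.
  near: h.
  have : (z \o shift a) h @[h --> 0] --> z a.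
    have : {for a, continuous z} by exact: cz.
    by rewrite continuous_shift forE /continuous_at/= add0r.
  move=> /cvgrPdist_le; apply.
  by rewrite divr_gt0// ltr_wpDl.
have dE := diff_unique (@dot_continuous R n (z a)) fE.
split=> //; apply/diff_locallyP; rewrite dE; split=> //.
exact: dot_continuous.
Unshelve. all: by end_near. Qed.

Lemma differentiable_subgradient a : continuous z -> differentiable f a.
Proof. by move=> /(diff_subgradient a)[]. Qed.

Lemma grad_subgradient a : continuous z -> grad f a = z a.
Proof.
move=> /(diff_subgradient a)[df dE]; apply/colP => i.
rewrite mxE deriveE// dE dotE (bigD1 i)//= mxE !eqxx mulr1.
by rewrite big1 ?addr0// => j /negPf ji; rewrite mxE ji mulr0.
Qed.

End subgradient.

(** * Existence of minimizers, projection and separation *)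

Section quadratic_growth.
Variables (R : realType) (n : nat) (X : set 'cV[R]_n).
Hypothesis clX : closed X.

Lemma argmin_of_quadratic_growth (f : 'cV[R]_n -> R) x0 g (k : R) :
  X x0 -> 0 < k -> {within X, continuous f} ->
  (forall y, X y ->
    f x0 + dot g (y - x0) + k * dot (y - x0) (y - x0) <= f y) ->
  exists2 z, X z & forall y, X y -> f z <= f y.
Proof.
move=> Xx0 k0 cf fg.
(* Beyond this radius the quadratic term dominates the linear one, so [f] is at least [f x0] there
   and a minimum over the compact set [S] is global. The factor [n] comes from [norm_dot_le]. *)
pose rho := n%:R * `|g| / k.
have rho0 : 0 <= rho by rewrite divr_ge0 ?mulr_ge0// ltW.
pose S := X `&` closed_ball_ Num.Def.normr x0 rho.
have Sx0 : S x0 by split=> //; rewrite /closed_ball_/= subrr normr0.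
have cS : compact S.
  apply: bounded_closed_compact_cV.
    exists (rho + `|x0|); split; first exact: num_real.
    move=> M rM y [_]; rewrite /closed_ball_/= => yr.
    rewrite (le_trans _ (ltW rM))// -lerBlDr (le_trans _ yr)// distrC.
    exact: lerB_dist.
  by apply: closedI => //; exact: closed_closed_ball_.
have [] := @compact_EVT_min _ _ f S _ cS.
- by exists x0.
- by apply: continuous_subspaceW cf => y [].
move=> z; rewrite inE => -[Xz zr] zmin; exists z => // y Xy.
have [yr|yr] := leP `|x0 - y| rho; first by apply: zmin; rewrite inE.
rewrite (le_trans (zmin _ (mem_set Sx0)))// (le_trans _ (fg _ Xy))//.
rewrite -addrA lerDl distrC in yr *.
set d := y - x0 in yr *.
have [d1 d2] := (norm_dot_le g d, sqr_norm_le_dot d).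
have gd : - (k * rho * `|d|) <= dot g d.
  rewrite lerNl (le_trans (ler_norm _))// normrN (le_trans d1)//.
  by rewrite [k * _]mulrC divfK ?gt_eqF// mulrA.
have : k * rho * `|d| <= k * dot d d.
  by rewrite -mulrA ler_pM2l// (le_trans _ d2)// expr2 ler_wpM2r//; exact: ltW.
lra.
Qed.

Hypothesis cvX : convex_set (X : set (convex_lmodType 'cV[R]_n)).

(** The normal is [c - p] with [p] the Euclidean projection of [c] onto [X]; minimality of the
    squared distance along segments issuing from [p] gives the inequality on [X]. *)
Lemma separating_hyperplane c : X !=set0 -> ~ X c ->
  exists a b, dot a c > b /\ forall x, X x -> dot a x <= b.
Proof.
move=> [x0 Xx0] Xc.
pose f y := dot (y - c) (y - c).
have fE (x y : 'cV[R]_n) (s : R) : f (s *: x + (1 - s) *: y) =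
    f y + s * (2 * dot (y - c) (x - y)) + s * (s * dot (x - y) (x - y)).
  rewrite /f !(dotDl, dotDr, dotZl, dotZr, dotNl, dotNr).
  rewrite (dotC x y) (dotC c y) (dotC c x); ring.
have [||y _|p Xp pmin] :=
  @argmin_of_quadratic_growth f x0 (2 *: (x0 - c)) 1 Xx0.
- by [].
- apply: continuous_subspaceT => y; apply: differentiable_continuous.
  apply: (@differentiable_subgradient _ _ _ (fun a => 2 *: (a - c))).
    move=> a b; have := fE b a 1; rewrite scale1r subrr scale0r addr0 => ->.
    by rewrite dotZl !mul1r lerDl dot_ge0.
  exact: continuous_scaled_translation.
- have := fE y x0 1; rewrite scale1r subrr scale0r addr0 => ->.
  by rewrite dotZl !mul1r.
exists (c - p), (dot (c - p) p); split.
  rewrite -subr_gt0 -dotNr -dotDr lt_neqAle dot_ge0 andbT eq_sym.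
  apply/eqP => d0; apply: Xc; suff -> : c = p by [].
  apply/eqP; rewrite -subr_eq0 -normr_eq0 -sqrf_eq0 eq_le sqr_ge0 andbT.
  by rewrite -d0 sqr_norm_le_dot.
move=> x Xx; rewrite -subr_ge0 -dotNr -dotDr -opprB dotNl -dotNr opprB.
apply/ler_addgt0Pr => e e0.
set D := dot _ _; set Q := dot (x - p) (x - p).
(* A step below 1 for which the second-order term [s * Q] is at most [e]. *)
pose s := Num.min (1 / 2) (e / (Q + 1)).
have Q0 : 0 <= Q by exact: dot_ge0.
have s0 : 0 < s by rewrite lt_min !divr_gt0//; lra.
have s1 : 0 < s < 1 by rewrite s0 /s gt_min; apply/orP; left; lra.
have := pmin _ (convex_setP cvX Xx Xp s1); rewrite fE -/D -/Q => h.
have : s * Q <= e.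
  have : s <= e / (Q + 1) by rewrite /s ge_min lexx orbT.
  by rewrite ler_pdivlMr ?ltr_wpDl//; lra.
have : 0 <= 2 * D + s * Q.
  by rewrite -(pmulr_rge0 _ s0) mulrDr; lra.
lra.
Qed.

End quadratic_growth.

Lemma lipschitz_const_continuous (R : realType) (V W : normedModType R)
    (f : V -> W) (k : R) :
  (forall a b, `|f a - f b| <= k * `|a - b|) -> continuous f.
Proof.
move=> fk a; apply/cvgrPdist_le => e e0; near=> b.
rewrite (le_trans (fk _ _))//.
rewrite (@le_trans _ _ ((`|k| + 1) * `|a - b|))//.
  by rewrite ler_wpM2r// (le_trans (ler_norm k))// lerDl.
rewrite -ler_pdivlMl ?ltr_wpDl// mulrC; near: b.
by apply: cvgr_dist_le => //; rewrite divr_gt0// ltr_wpDl.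
Unshelve. all: by end_near. Qed.

Lemma gradN (R : realType) (n : nat) (f : 'cV[R]_n -> R) x :
  differentiable f x -> grad (fun y => - f y) x = - grad f x.
Proof.
move=> df; apply/colP => i; rewrite !mxE.
by rewrite -deriveN; last exact: diff_derivable.
Qed.

(** * Convex conjugates and mirror maps *)

Section mirror_map.
Variables (R : realType) (n : nat) (X : set 'cV[R]_n).
Variables (psi : 'cV[R]_n -> \bar R) (psiS : 'cV[R]_n -> R).
Hypothesis mX : mirror_assumption X psi psiS.
Hypothesis clX : closed X.
Hypothesis cvX : convex_set (X : set (convex_lmodType 'cV[R]_n)).

Let psiSE x : X x -> psi x = (psiS x)%:E.
Proof. by case: mX => _ + _ _ _; exact. Qed.

Let dpsiS x : X x -> differentiable psiS x.
Proof. by case: mX => _ _ [U [_ XU C1]] _ _ /XU/C1[]. Qed.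

Let psi_outside x : ~ X x -> psi x = +oo%E.
Proof.
case: mX => -[_ _ _ <-] _ _ _ _ /negP; rewrite -leNgt leye_eq => /eqP //.
Qed.

(** First-order form of strong convexity: differentiate at [y] along the segment to [x], which stays
    in [X], where [psi] and [psiS] agree. *)
Let quadratic_minorant : exists2 k : R, 0 < k & forall x y, X x -> X y ->
  psiS y + dot (grad psiS y) (x - y) + k * dot (x - y) (x - y) <= psiS x.
Proof.
have [[_ _ [mu mu0 sc] _] _ _ _ _] := mX.
exists (mu / 2); first by rewrite divr_gt0.
move=> x y Xx Xy; set Q := dot (x - y) (x - y).
suff : dot (grad psiS y) (x - y) <= psiS x - psiS y - mu / 2 * Q by lra.
apply: (@convex_derive_le _ _ _ _ _ _ (mu / 2 * Q)); first exact: dpsiS.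
move=> a a01; have := sc x y a a01.
rewrite !psiSE//; last exact: convex_setP.
rewrite -!EFinM -EFinD lee_fin -/Q => /le_trans; apply.
by rewrite le_eqVlt; apply/orP; left; apply/eqP; ring.
Qed.

(** The minorant based at any point of [X] yields a minimizer [z] of [psiS] minus the linear form
    [u]. Optimality along segments in [X] gives the variational inequality, and inserting that into
    the minorant based at [z] gives quadratic growth. *)
Let argmin_exists : exists2 k : R, 0 < k & forall u, exists z,
  [/\ X z,
   forall y, X y -> 0 <= dot (grad psiS z - u) (y - z) &
   forall y, X y ->
     psiS z - dot z u + k * dot (y - z) (y - z) <= psiS y - dot y u].
Proof.
have [[[_ [x0 Xx0]] _ _ domX] _ _ _ _] := mX; rewrite domX in Xx0.
have [k k0 psik] := quadratic_minorant; exists k => // u.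
pose f y := psiS y - dot y u.
have fk y z : X y -> X z ->
    f z + dot (grad psiS z - u) (y - z) + k * dot (y - z) (y - z) <= f y.
  move=> Xy Xz; have := psik _ _ Xy Xz; rewrite /f.
  set Q := dot (y - z) (y - z).
  by rewrite !(dotDl, dotDr, dotNl, dotNr) (dotC u y) (dotC u z); lra.
have cf : {within X, continuous f}.
  apply: continuous_in_subspaceT => y; rewrite inE => Xy.
  apply: differentiable_continuous.
  rewrite (_ : f = psiS \- dot u); last by apply/funext => ?; rewrite /f dotC.
  by apply: differentiableB; [exact: dpsiS|exact: differentiable_dot].
have [z Xz zmin] := argmin_of_quadratic_growth clX Xx0 k0 cf
  (fun y Xy => fk y x0 Xy Xx0).
have opt y : X y -> 0 <= dot (grad psiS z - u) (y - z).
  move=> Xy; rewrite dotDl dotNl subr_ge0 -lerN2 -dotNl.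
  rewrite -gradN; last exact: dpsiS.
  apply: (@convex_derive_le _ _ _ _ _ _ 0).
    exact/differentiableN/dpsiS.
  move=> a a01; have := zmin _ (convex_setP cvX Xy Xz a01).
  rewrite /f mulr0 addr0 !(dotDl, dotDr, dotZl, dotNl, dotNr).
  by rewrite (dotC u y) (dotC u z); lra.
exists z; split=> // y Xy; rewrite -/(f _) -/(f _).
by have := fk _ _ Xy Xz; have := opt _ Xy; lra.
Qed.

(** The supremum defining the conjugate is attained at the minimizer [z u], which is therefore a
    subgradient of the conjugate at [u]. As [z] is continuous, it is the gradient. *)
Lemma grad_conjugateP :
  [/\ forall u, X (grad_conjugate psi u),
      forall u y, X y -> 0 <= dot (grad psiS (grad_conjugate psi u) - u)
                                  (y - grad_conjugate psi u),
      forall a b, fine (conjugate psi a) + dot (grad_conjugate psi a) (b - a) <=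
                  fine (conjugate psi b) &
      forall u, differentiable (fun u => fine (conjugate psi u)) u].
Proof.
have [k k0 /choice[z zP]] := argmin_exists.
have conjE u : fine (conjugate psi u) = dot (z u) u - psiS (z u).
  have [Xz _ zmin] := zP u.
  rewrite (_ : conjugate psi u = (dot (z u) u - psiS (z u))%:E)//.
  apply/eqP; rewrite eq_le; apply/andP; split; last first.
    by apply: ereal_sup_ubound; exists (z u) => //; rewrite psiSE.
  apply: ge_ereal_sup => _ [y _ <-].
  have [Xy|Xy] := pselect (X y); last by rewrite psi_outside// addeNy leNye.
  rewrite psiSE// -EFinB lee_fin; have := zmin _ Xy.
  by have := mulr_ge0 (ltW k0) (dot_ge0 (y - z u)); lra.
have sub a b : fine (conjugate psi a) + dot (z a) (b - a) <=
               fine (conjugate psi b).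
  rewrite !conjE dotDr dotNr; have [Xz _ _] := zP a.
  have [_ _ /(_ _ Xz)] := zP b.
  by have := mulr_ge0 (ltW k0) (dot_ge0 (z a - z b)); lra.
(* Adding the quadratic growth at [z a], tested at [z b], to the one with the roles exchanged
   cancels [psiS] and bounds [dot d d] by a multiple of [dot d (a - b)]. *)
have lipz a b : `|z a - z b| <= n%:R / k * `|a - b|.
  have [Xa _ za] := zP a; have [Xb _ zb] := zP b.
  have := za _ Xb; have {za zb} := zb _ Xa.
  rewrite -(opprB (z a) (z b)) dotNl dotNr opprK; set d := z a - z b => h1 h2.
  have h : k * dot d d <= dot d (a - b).
    have -> : dot d (a - b) =
        dot (z a) a - dot (z a) b - dot (z b) a + dot (z b) b.
      by rewrite /d !(dotDl, dotDr, dotNl, dotNr); ring.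
    by have := mulr_ge0 (ltW k0) (dot_ge0 d); lra.
  have [->|d0] := eqVneq `|d| 0; first by rewrite mulr_ge0// divr_ge0// ltW.
  have d0' : 0 < `|d| by rewrite lt_neqAle eq_sym d0/=.
  rewrite mulrAC ler_pdivlMr// mulrC -(ler_pM2l d0') mulrCA -expr2.
  rewrite (@le_trans _ _ (k * dot d d))// ?ler_pM2l ?sqr_norm_le_dot//.
  rewrite (le_trans h)// (le_trans (ler_norm _))// mulrCA.
  exact: norm_dot_le.
have cz : continuous z := lipschitz_const_continuous lipz.
have gz u : grad_conjugate psi u = z u by exact: grad_subgradient.
split=> [u|u y Xy|a b|u].
- by rewrite gz; case: (zP u).
- by rewrite gz; case: (zP u) => _ + _; exact.
- by rewrite gz.
- exact: differentiable_subgradient.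
Qed.

End mirror_map.

(** * Derivatives along curves and invariance of convex sets *)

Lemma is_derive_comp_curve (R : realType) (n : nat) (f : 'cV[R]_n -> R)
    (c : R -> 'cV[R]_n) (t : R) :
  differentiable f (c t) -> derivable c t 1 ->
  is_derive t 1 (fun s => f (c s)) (dot (grad f (c t)) (derive1 c t)).
Proof.
move=> df /derivable1_diffP dc.
have dfc : differentiable (f \o c) t by exact: differentiable_comp.
apply: DeriveDef; first exact: diff_derivable.
rewrite -[LHS]/('D_1 (f \o c) t) deriveE// diff_comp//= derive1E'//.
by rewrite -derive_dot_grad// deriveE.
Qed.

Lemma grad_dot (R : realType) (n : nat) (a x : 'cV[R]_n) : grad (dot a) x = a.
Proof.
apply: (@grad_subgradient _ _ _ (fun=> a)) => [y z|].
  by rewrite dotDr dotNr addrCA subrr addr0.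
exact: cst_continuous.
Qed.

Lemma is_derive_dot_curve (R : realType) (n : nat) (a : 'cV[R]_n)
    (c : R -> 'cV[R]_n) (t : R) : derivable c t 1 ->
  is_derive t 1 (fun s => dot a (c s)) (dot a (derive1 c t)).
Proof.
move=> dc; have := is_derive_comp_curve (differentiable_dot a (c t)) dc.
by rewrite grad_dot.
Qed.

(* A functional separating [x t] from [X] would be maximal along the curve at
   some [c > 0], where it points strictly inwards. *)
Lemma averaged_curve_in_convex (R : realType) (n : nat) (X : set 'cV[R]_n)
    (r : R) (x z : R -> 'cV[R]_n) :
  closed X -> convex_set (X : set (convex_lmodType 'cV[R]_n)) -> 0 < r ->
  regular_curve x -> X (x 0) -> (forall t : R, 0 < t -> X (z t)) ->
  (forall t : R, 0 < t -> derive1 x t = (r / t) *: (z t - x t)) ->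
  forall t : R, 0 <= t -> X (x t).
Proof.
move=> clX cvX r0 [cx dx] X0 Xz xz t t0; apply: contrapT => Xt.
have [a [b [ab aX]]] := separating_hyperplane clX cvX (ex_intro _ _ X0) Xt.
pose f s := dot a (x s).
have cf : {within `[0, t], continuous f}.
  apply: (@within_continuous_comp _ _ _ _ x (dot a)) => [y _|].
    exact: dot_continuous.
  by apply: continuous_subspaceW cx => s /=; rewrite !in_itv/= => /andP[->].
have [c] := EVT_max t0 cf; rewrite in_itv/= => /andP[c0 ct] cmax.
have fc : b < f c.
  by rewrite (lt_le_trans ab)// cmax// in_itv/= t0 lexx.
have {}c0 : 0 < c.
  rewrite lt_neqAle c0 andbT; apply/eqP => c0'; move: fc.
  by rewrite -c0' ltNge aX.
have [dfc] := is_derive_dot_curve a (dx _ c0); rewrite -/f => fc'.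
(* The maximum is over [[0, t]] and [c] may equal [t], so only backward steps in time are
   compared. *)
have : 'D_(-1) f c <= 0.
  apply: derive_right_le; first exact/diff_derivable/derivable1_diffP.
  move=> e e0; near=> h; have h0 : 0 < h by [].
  rewrite (@le_trans _ _ (f c))//; last by rewrite lerDl mulr_ge0 ?add0r ?ltW.
  apply: cmax; rewrite in_itv/= [h *: _]mulrN1; apply/andP; split.
    rewrite addrC subr_ge0; near: h; exact: nbhs_right_le.
  by rewrite (le_trans _ ct)// gerDr oppr_le0 ltW.
rewrite deriveE; last exact/derivable1_diffP.
rewrite linearN -deriveE ?oppr_le0; last exact/derivable1_diffP.
rewrite fc' xz// dotZr dotDr dotNr pmulr_rge0 ?divr_gt0// subr_ge0.
by move=> /(lt_le_trans fc); rewrite ltNge aX//; exact: Xz.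
Unshelve. all: by end_near. Qed.

(** * Growth of strictly convex functions away from a minimizer *)

Lemma closed_sphere (R : realType) (V : normedModType R) (c : V) (e : R) :
  closed [set x | `|c - x| = e].
Proof.
have cn : continuous (fun x : V => `|c - x| : R^o).
  apply: (@lipschitz_const_continuous R V R^o _ 1) => a b.
  by rewrite mul1r (le_trans (ler_dist_dist _ _))// opprB addrC subrKA distrC.
have := (continuous_closedP _).1 cn [set e]; apply.
exact: closed_eq.
Qed.

(** The margin [m] is the excess of the minimum of [f] on the compact part of [X] at distance [e]
    from [xs]. A farther point can be pulled back radially to that sphere without increasing [f]. *)
Lemma strictly_convex_growth (R : realType) (n : nat) (X : set 'cV[R]_n)
    (f : 'cV[R]_n -> R) (xs : 'cV[R]_n) :
  closed X -> strictly_convex_on X f -> {within X, continuous f} ->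
  X xs -> (forall x, X x -> f xs <= f x) ->
  forall e : R, 0 < e -> exists2 m : R, 0 < m &
    forall x, X x -> f x < f xs + m -> `|xs - x| < e.
Proof.
move=> clX [cvX scf] cf Xs fmin e e0.
pose S := X `&` [set x | `|xs - x| = e].
have cS : compact S.
  apply: bounded_closed_compact_cV.
    exists (e + `|xs|); split; first exact: num_real.
    move=> M eM y [_ /= ye]; rewrite (le_trans _ (ltW eM))// -lerBlDr -ye.
    by rewrite distrC; exact: lerB_dist.
  by apply: closedI => //; exact: closed_sphere.
have scale x : X x -> e <= `|xs - x| -> exists a : R,
    [/\ 0 < a <= 1, S (a *: x + (1 - a) *: xs) &
     f (a *: x + (1 - a) *: xs) <= f x].
  move=> Xx ex; have d0 : 0 < `|xs - x| by exact: lt_le_trans ex.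
  exists (e / `|xs - x|); set a := e / _.
  have a0 : 0 < a by rewrite divr_gt0.
  have a1 : a <= 1 by rewrite ler_pdivrMr// mul1r.
  have fx := fmin _ Xx.
  have ae : `|xs - (a *: x + (1 - a) *: xs)| = e.
    rewrite (_ : _ - _ = a *: (xs - x)).
      by rewrite normrZ gtr0_norm// divfK ?gt_eqF.
    by apply/colP => i; rewrite !mxE; ring.
  rewrite a0 a1.
  have [a1'|a1'] := eqVneq a 1.
    move: ae; rewrite a1' subrr scale0r addr0 scale1r => ae.
    by split.
  have a01 : 0 < a < 1 by rewrite a0 lt_neqAle a1' a1.
  split => //; first by split => //; exact: convex_setP.
  have xxs : x != xs by apply/eqP => xE; move: d0; rewrite xE subrr normr0 ltxx.
  have := scf _ _ _ Xx Xs xxs a01.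
  have : a * (f x - f xs) <= f x - f xs by rewrite ler_piMl// subr_ge0.
  lra.
have [S0|/set0P/negP/negPn/eqP S0] := pselect (S !=set0); last first.
  (* If the sphere misses [X], no point of [X] is at distance [e] or more, and any margin works. *)
  exists 1 => // x Xx _; rewrite ltNge; apply/negP => /(scale _ Xx)[a []].
  by rewrite S0.
have [c] := compact_EVT_min S0 cS (continuous_subspaceW (@subIsetl _ _ _) cf).
rewrite inE => -[Xc /= ce] cmin; exists (f c - f xs).
  rewrite subr_gt0.
  have cxs : c != xs.
    by apply/eqP => cE; move: e0; rewrite -ce cE subrr normr0 ltxx.
  (* The midpoint of [c] and [xs] would lie below the minimum if [f c] were equal to [f xs]. *)
  have h : 0 < (1 / 2 : R) < 1 by apply/andP; split; lra.
  have := scf _ _ _ Xc Xs cxs h.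
  by have := fmin _ (convex_setP cvX Xc Xs h); lra.
move=> x Xx fx; rewrite ltNge; apply/negP => /(scale _ Xx)[a [a01 Sa fa]].
by have := cmin _ (mem_set Sa); lra.
Qed.

(** * One player, driven by the objective and an external force [h] *)

Section one_player.
Variables (R : realType) (n : nat) (X : set 'cV[R]_n) (F : 'cV[R]_n -> R).
Hypothesis oX : objective_assumption X F.

Lemma objective_differentiable x : X x -> differentiable F x.
Proof. by case: oX => _ _ _ [U [_ XU C1 _]] _ /XU/C1[]. Qed.

Lemma objective_gradient_le x y : X x -> X y ->
  dot (grad F y) (x - y) <= F x - F y.
Proof.
case: oX => _ _ _ [U [_ XU _ [_ sF]]] _ Xx Xy.
apply: (@convex_derive_le _ _ _ _ _ _ 0); first exact: objective_differentiable.
move=> a a01; rewrite mulr0 addr0.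
have [->|xy] := eqVneq x y.
  by rewrite -scalerDl addrCA subrr addr0 scale1r; lra.
by have := sF _ _ _ (XU _ Xx) (XU _ Xy) xy a01; lra.
Qed.

(** A linear term preserves strict convexity; [h] will be the coupling with the opponent frozen at
    the saddle point. *)
Lemma objective_growth (h xs : 'cV[R]_n) : X xs ->
  (forall x, X x -> F xs + dot h xs <= F x + dot h x) ->
  forall e : R, 0 < e -> exists2 m : R, 0 < m &
    forall x, X x -> F x + dot h x < F xs + dot h xs + m -> `|xs - x| < e.
Proof.
move=> Xxs; apply: (@strictly_convex_growth _ _ X (F \+ dot h)) => //.
- by case: oX.
- split; first by case: oX.
  case: oX => _ _ _ [U [_ XU _ [_ sF]]] _ x y a Xx Xy xy a01.
  have := sF _ _ _ (XU _ Xx) (XU _ Xy) xy a01.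
  by rewrite /= dotDr !dotZr; lra.
- apply: continuous_in_subspaceT => x; rewrite inE => Xx.
  apply: differentiable_continuous.
  apply: differentiableD; last exact: differentiable_dot.
  exact: objective_differentiable.
Qed.

Lemma objective_curve_continuous (x : R -> 'cV[R]_n) (I : set R) :
  (forall t, I t -> X (x t)) -> {within I, continuous x} ->
  {within I, continuous (fun t => F (x t))}.
Proof.
move=> Xx cx; apply: (@within_continuous_comp _ _ _ _ x F) => // y.
rewrite inE => -[t It <-]; apply: differentiable_continuous.
exact/objective_differentiable/Xx.
Qed.

Variables (psi : 'cV[R]_n -> \bar R) (psiS : 'cV[R]_n -> R).
Hypothesis mX : mirror_assumption X psi psiS.
Variables (r : R) (x u h : R -> 'cV[R]_n) (xs : 'cV[R]_n).
Hypothesis r0 : 0 < r.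
Hypothesis (rx : regular_curve x) (ru : regular_curve u).
Hypothesis x_eq : forall t : R, 0 < t ->
  derive1 x t = (r / t) *: (grad_conjugate psi (u t) - x t).
Hypothesis u_eq : forall t : R, 0 < t ->
  derive1 u t = (t / r) *: (- grad F (x t) - h t
    + grad psiS (x t + (t / r) *: derive1 x t) - u t).
Hypothesis x_init : x 0 = grad_conjugate psi (u 0).

Lemma mirror_position (t : R) : 0 < t ->
  x t + (t / r) *: derive1 x t = grad_conjugate psi (u t).
Proof.
move=> t0; rewrite x_eq// scalerA mulrA divfK ?gt_eqF// divff ?gt_eqF//.
by rewrite scale1r addrC subrK.
Qed.

(** The velocity always points towards the mirror point, which lies in [X]. The convexity and
    smoothness data for [F] are thereby available along the curve. *)
Lemma trajectory_in_domain (t : R) : 0 <= t -> X (x t).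
Proof.
have [_ clX cvX _ _] := oX.
have [Xg _ _ _] := grad_conjugateP mX clX cvX.
apply: (averaged_curve_in_convex clX cvX r0 rx _ _ x_eq) => //.
by rewrite x_init.
Qed.

(* The Bregman distance of [psi^*] from [us] to [u t], up to a constant. *)
Definition conjugate_energy (t : R) : R :=
  fine (conjugate psi (u t)) - dot xs (u t).

(** This is the subgradient inequality of the conjugate at [us], that is, nonnegativity of the
    Bregman distance. *)
Lemma conjugate_energy_ge us : xs = grad_conjugate psi us ->
  forall t, fine (conjugate psi us) - dot xs us <= conjugate_energy t.
Proof.
have [_ clX cvX _ _] := oX.
have [_ _ sub _] := grad_conjugateP mX clX cvX.
move=> xsE t; have := sub us (u t); rewrite -xsE.
by rewrite /conjugate_energy dotDr dotNr; lra.
Qed.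

Lemma conjugate_energy_continuous :
  {within `[0, +oo[, continuous conjugate_energy}.
Proof.
have [_ clX cvX _ _] := oX.
have [_ _ _ dc] := grad_conjugateP mX clX cvX.
apply: (@within_continuous_comp _ _ _ _ u
  (fun v => fine (conjugate psi v) - dot xs v)) => [v _|]; last by case: ru.
by apply: differentiable_continuous; apply: differentiableB => //;
  exact: differentiable_dot.
Qed.

Lemma is_derive_conjugate_energy (t : R) : 0 < t ->
  is_derive t 1 conjugate_energy
    (dot (grad_conjugate psi (u t) - xs) (derive1 u t)).
Proof.
move=> t0; have [_ clX cvX _ _] := oX.
have [_ _ _ dc] := grad_conjugateP mX clX cvX.
have du : derivable u t 1 by case: ru => _; exact.
rewrite dotDl dotNl; apply: is_deriveB.
  exact: (is_derive_comp_curve (dc (u t)) du).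
exact: is_derive_dot_curve.
Qed.

(* Variational inequality for [grad psi^*(u)] plus convexity of [F]; the
   derivative of [F] along [x] is kept because it enters the energy. *)
Lemma derive_conjugate_energy_le (t : R) : 0 < t -> X xs ->
  r * dot (grad_conjugate psi (u t) - xs) (derive1 u t) <=
  - t * (F (x t) - F xs + dot (h t) (grad_conjugate psi (u t) - xs))
  - t * (t / r) * dot (grad F (x t)) (derive1 x t).
Proof.
move=> t0 Xxs; have [_ clX cvX _ _] := oX; set z := grad_conjugate _ _.
have [Xg vi _ _] := grad_conjugateP mX clX cvX.
have Xt := trajectory_in_domain (ltW t0).
have zE : z = x t + (t / r) *: derive1 x t by rewrite mirror_position.
rewrite u_eq// -zE dotZr mulrA mulrCA divff ?gt_eqF// mulr1.
have := vi (u t) xs Xxs; rewrite -/z -(opprB z xs) dotNr => viz.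
have := objective_gradient_le Xxs Xt.
rewrite -(opprB (x t) xs) dotNr => Fle.
(* Splitting [z - xs] into [x t - xs] and [t / r] times the velocity separates the convexity term of
   [F] from its derivative along the curve. *)
have -> : dot (z - xs) (- grad F (x t) - h t + grad psiS z - u t) =
  dot (grad psiS z - u t) (z - xs) - dot (h t) (z - xs)
    - dot (grad F (x t)) (x t - xs)
    - (t / r) * dot (grad F (x t)) (derive1 x t).
  have -> : dot (grad F (x t)) (x t - xs) =
      dot (grad F (x t)) (z - xs) - t / r * dot (grad F (x t)) (derive1 x t).
    by rewrite zE -dotZr -dotNr -dotDr addrAC addrK.
  by rewrite [LHS]dotC !(dotDl _ _ (z - xs)) !(dotNl _ (z - xs)); ring.
rewrite !mulrBr; set a := dot _ _ in viz *; set b := dot _ _ in Fle *.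
set c := t / r * _.
have : t * a <= 0 by rewrite pmulr_rle0// -oppr_ge0.
have : t * (F (x t) - F xs) <= t * b by rewrite ler_pM2l//; lra.
rewrite -[t * (t / r) * _]mulrA -/c; lra.
Qed.

End one_player.

(** * Assembling the energy of both players *)

Lemma energy_decay (R : realFieldType)
    (r t c A B f g p p' q q' s1 s2 E1 E2 : R) :
  2 <= r -> 0 < t -> r * c = t -> 0 <= A + p + B - q ->
  r * E1 <= - t * (A + s1) - t * c * f ->
  r * E2 <= - t * (B + s2) - t * c * g ->
  s1 + s2 = p + c * p' - (q + c * q') ->
  t * t * (f + p' + g - q') + (A + p + B - q) * (t + t) + r * r * (E1 + E2)
    <= 0.
Proof.
move=> r2 t0 rc gap hE1 hE2 s12.
have r0 : 0 <= r by lra.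
(* Since [r * c = t], the terms in [f], [g], [p'] and [q'] cancel the derivative of the gap, scaled
   by [t * t]. What remains is [2 - r] times [t] times the gap. *)
have h : r * (r * E1 + r * E2) <=
    r * (- t * (A + B + (s1 + s2)) - t * c * (f + g)).
  by rewrite ler_wpM2l//; lra.
have {}gap : 0 <= (r - 2) * (t * (A + p + B - q)).
  by rewrite mulr_ge0 ?subr_ge0// mulr_ge0// ltW.
rewrite s12 -rc in h; rewrite -rc in gap *; lra.
Qed.

Lemma is_derive_energy (R : realType) (g e1 e2 : R -> R) (k t dg d1 d2 : R) :
  is_derive t 1 g dg -> is_derive t 1 e1 d1 -> is_derive t 1 e2 d2 ->
  is_derive t 1 (fun s => s * s * g s + k * (e1 s + e2 s))
    (t * t * dg + g t * (t + t) + k * (d1 + d2)).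
Proof.
move=> dg' d1' d2'.
rewrite (_ : (fun _ => _) = id * id * g + cst k * (e1 + e2)); last exact/funext.
apply: is_derive_eq; rewrite /= /GRing.scale/= !mulr1 mulr0 addr0.
by [].
Qed.

Lemma cvg_pair_norm (R : realType) (V W : normedModType R) (f : R -> V)
    (g : R -> W) (a : V) (b : W) :
  (forall e : R, 0 < e ->
    \forall t \near +oo, `|a - f t| < e /\ `|b - g t| < e) ->
  (f t, g t) @[t --> +oo] --> (a, b).
Proof.
by move=> h; apply: cvg_pair; apply/cvgrPdist_lt => e /h;
  apply: filterS => t [].
Qed.

Theorem theorem2 (R : realType) (p q : nat) (r : R) (hr : 2 <= r)
    (H : 'M[R]_(p, q)) (X : set 'cV[R]_p) (Y : set 'cV[R]_q)
    (F : 'cV[R]_p -> R) (G : 'cV[R]_q -> R)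
    (psi : 'cV[R]_p -> \bar R) (psiS : 'cV[R]_p -> R)
    (phi : 'cV[R]_q -> \bar R) (phiS : 'cV[R]_q -> R)
    (hA : assumption_A X Y F G H)
    (hB : assumption_B X Y psi psiS phi phiS)
    (x u : R -> 'cV[R]_p) (y v : R -> 'cV[R]_q)
    (htraj : trajectory r H F G psi psiS phi phiS x u y v)
    (xs us : 'cV[R]_p) (ys vs : 'cV[R]_q)
    (hequil : equilibrium H F G psi psiS phi phiS xs us ys vs)
    (hsaddle : saddle_point X Y (lagrangian F G H) xs ys) :
  inverse_square_rate
    (fun t : R => lagrangian F G H (x t) ys - lagrangian F G H xs (y t)) /\
  (x t, y t) @[t --> +oo] --> (xs, ys).
Proof.
have [oX oY _] := hA; have [mX mY] := hB.
have [[rx ru ry rv] x_eq y_eq u_eq v_eq x0 _ y0 _] := htraj.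
have [xsE ysE _ _] := hequil; have [Xxs Yys saddle] := hsaddle.
have r0 : 0 < r by lra.
pose gap (t : R) := lagrangian F G H (x t) ys - lagrangian F G H xs (y t).
(* The gap contains no product of [x t] and [y t]: it is a function of [x t] plus a function of
   [y t]. *)
have gapE (t : R) : gap t =
    (F (x t) - F xs) + dot (H *m ys) (x t) + (G (y t) - G ys)
    - dot (H^T *m xs) (y t).
  rewrite /gap /lagrangian (dotC (x t)) dot_mulmxr; ring.
(* The maximizing player is a minimizer of [G] with coupling force of opposite sign, so the
   one-player results apply to both. *)
have v_eq' (t : R) : 0 < t -> derive1 v t = (t / r) *: (- grad G (y t)
    - - (H^T *m (x t + (t / r) *: derive1 x t))
    + grad phiS (y t + (t / r) *: derive1 y t) - v t).
  by move=> t0; rewrite v_eq// opprK.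
have Xx := trajectory_in_domain oX mX r0 rx x_eq x0.
have Yy := trajectory_in_domain oY mY r0 ry y_eq y0.
have gap0 (t : R) : 0 <= t -> 0 <= gap t.
  move=> t0; have /andP[h1 h2] := saddle _ _ (Xx _ t0) (Yy _ t0).
  by rewrite subr_ge0 (le_trans h1).
pose E1 := conjugate_energy psi u xs; pose E2 := conjugate_energy phi v ys.
pose V (t : R) := t * t * gap t + r * r * (E1 t + E2 t).
have dgap (t : R) : 0 < t -> is_derive t 1 gap
    (dot (grad F (x t)) (derive1 x t) + dot (H *m ys) (derive1 x t)
     + dot (grad G (y t)) (derive1 y t) - dot (H^T *m xs) (derive1 y t)).
  move=> t0; rewrite (_ : gap = fun t => (F (x t) - F xs)
    + dot (H *m ys) (x t) + (G (y t) - G ys) - dot (H^T *m xs) (y t));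
    last exact/funext.
  have dx : derivable x t 1 by case: rx => _; exact.
  have dy : derivable y t 1 by case: ry => _; exact.
  have dF :=
    is_derive_comp_curve (objective_differentiable oX (Xx _ (ltW t0))) dx.
  have dG :=
    is_derive_comp_curve (objective_differentiable oY (Yy _ (ltW t0))) dy.
  have dHx := is_derive_dot_curve (H *m ys) dx.
  have dHy := is_derive_dot_curve (H^T *m xs) dy.
  apply: is_deriveB; apply: is_deriveD; [apply: is_deriveD|].
    by rewrite -[X in is_derive _ _ _ X]subr0; apply: is_deriveB.
  by rewrite -[X in is_derive _ _ _ X]subr0; apply: is_deriveB.
have dV (t : R) : 0 < t -> derivable V t 1 /\ derive1 V t <= 0.
  move=> t0.
  have dg := dgap _ t0.
  have d1 := is_derive_conjugate_energy oX mX xs ru t0.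
  have d2 := is_derive_conjugate_energy oY mY ys rv t0.
  have [dVt dVE] : is_derive t 1 V (t * t *
    (dot (grad F (x t)) (derive1 x t) + dot (H *m ys) (derive1 x t)
     + dot (grad G (y t)) (derive1 y t) - dot (H^T *m xs) (derive1 y t))
     + gap t * (t + t) + r * r *
     (dot (grad_conjugate psi (u t) - xs) (derive1 u t) +
      dot (grad_conjugate phi (v t) - ys) (derive1 v t))).
    exact: is_derive_energy.
  split=> //; rewrite derive1E dVE gapE.
  apply: (energy_decay hr t0 (c := t / r) _ _
    (derive_conjugate_energy_le oX mX r0 rx x_eq u_eq x0 t0 Xxs)
    (derive_conjugate_energy_le oY mY r0 ry y_eq v_eq' y0 t0 Yys)).
  - by rewrite mulrC divfK ?gt_eqF.
  - by rewrite -gapE gap0// ltW.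
  rewrite -(mirror_position r0 x_eq t0) -(mirror_position r0 y_eq t0).
  set z := x t + _; set w := y t + _.
  (* The two coupling forces contribute [dot z (H *m w)] with opposite signs; only pairings with
     [xs] and [ys] survive. *)
  transitivity (dot (H *m ys) z - dot (H^T *m xs) w); last first.
    by rewrite /z /w !dotDr !dotZr.
  move: z w => z w.
  rewrite dotNl !(dotDr, dotNr) -!dot_mulmxr !(dotC _ (H *m _)).
  ring.
(* The equations hold only for [t > 0]; continuity at 0 extends the monotonicity of [V] to the
   initial time. *)
have cV : {within `[0, +oo[, continuous V}.
  have Ix (s : R) : `[0, +oo[%classic s -> X (x s).
    by rewrite /= in_itv/= andbT; exact: Xx.
  have Iy (s : R) : `[0, +oo[%classic s -> Y (y s).
    by rewrite /= in_itv/= andbT; exact: Yy.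
  have [[cx _] [cy _]] := (rx, ry).
  have cF := objective_curve_continuous oX Ix cx.
  have cG := objective_curve_continuous oY Iy cy.
  have cE1 := conjugate_energy_continuous oX mX (xs := xs) ru.
  have cE2 := conjugate_energy_continuous oY mY (xs := ys) rv.
  have cHx : {within `[0, +oo[, continuous (fun t => dot (H *m ys) (x t))}.
    apply: (@within_continuous_comp _ _ _ _ x) => // ? _.
    exact: dot_continuous.
  have cHy : {within `[0, +oo[, continuous (fun t => dot (H^T *m xs) (y t))}.
    apply: (@within_continuous_comp _ _ _ _ y) => // ? _.
    exact: dot_continuous.
  have cid : {within `[0, +oo[, continuous (fun t : R => t)}.
    by apply: continuous_subspaceT => ?; exact: cvg_id.
  rewrite (_ : V = fun t => t * t * ((F (x t) - F xs) + dot (H *m ys) (x t)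
    + (G (y t) - G ys) - dot (H^T *m xs) (y t)) + r * r * (E1 t + E2 t)).
  move=> t; apply: cvgD; apply: cvgM.
  - by apply: cvgM; exact: cid.
  - apply: cvgB; last exact: cHy.
    apply: cvgD; last by apply: cvgB; [exact: cG|exact: cvg_cst].
    apply: cvgD; last exact: cHx.
    by apply: cvgB; [exact: cF|exact: cvg_cst].
  - exact: cvg_cst.
  - by apply: cvgD; [exact: cE1|exact: cE2].
  by apply/funext => t; rewrite /V gapE.
have V_le (t : R) : 0 < t -> V t <= V 0.
  move=> t0; apply: (ler0_derive1_nincry _ _ cV) (lexx _) (ltW t0) => s;
    by rewrite in_itv/= andbT => /dV[].
(* The gap term of [V] vanishes at time 0, so [C] is [r * r] times the sum of the two initial
   Bregman distances. *)
pose C := r * r * (E1 0 + E2 0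
  - (fine (conjugate psi us) - dot xs us)
  - (fine (conjugate phi vs) - dot ys vs)).
have gapC (t : R) : 0 < t -> gap t <= C / t ^+ 2.
  move=> t0; rewrite ler_pdivlMr ?exprn_gt0//.
  have := V_le _ t0; rewrite /V !mul0r add0r /C expr2.
  have e1 := conjugate_energy_ge oX mX u xsE t.
  have e2 := conjugate_energy_ge oY mY v ysE t.
  rewrite -/E1 -/E2 in e1 e2.
  set m1 := _ - dot xs us in e1 *; set m2 := _ - dot ys vs in e2 *.
  have : r * r * (m1 + m2) <= r * r * (E1 t + E2 t).
    by apply: ler_wpM2l; [rewrite mulr_ge0// ltW|exact: lerD].
  by rewrite [gap t * _]mulrC; lra.
split.
  by exists C => t t0; apply/andP; split; [exact/gap0/ltW|exact: gapC].
have gap_small (m : R) : 0 < m -> \forall t \near +oo, 0 < t /\ gap t < m.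
  move=> m0; near=> t.
  have t0 : 0 < t by [].
  have t1 : 1 < t by [].
  split=> //; rewrite (le_lt_trans (gapC _ t0))// ltr_pdivrMr ?exprn_gt0//.
  (* For [t > 1] the square exceeds [t], so [t] beyond [C / m] is enough. *)
  rewrite -ltr_pdivrMl//; apply: (@lt_trans _ _ t); last first.
    by rewrite expr2 ltr_pMr.
  by near: t; apply: nbhs_pinfty_gt; exact: num_real.
have minX z : X z -> F xs + dot (H *m ys) xs <= F z + dot (H *m ys) z.
  move=> Xz; have /andP[_] := saddle _ _ Xz Yys.
  by rewrite /lagrangian !(dotC _ (H *m ys)); lra.
have minY z : Y z ->
    G ys + dot (- (H^T *m xs)) ys <= G z + dot (- (H^T *m xs)) z.
  move=> Yz; have /andP[+ _] := saddle _ _ Xxs Yz.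
  by rewrite /lagrangian !dot_mulmxr !dotNl; lra.
have near_saddle (e : R) : 0 < e ->
    \forall t \near +oo, `|xs - x t| < e /\ `|ys - y t| < e.
  move=> e0; have [m1 m10 h1] := objective_growth oX Xxs minX e0.
  have [m2 m20 h2] := objective_growth oY Yys minY e0.
  have m0 : 0 < Num.min m1 m2 by rewrite lt_min m10.
  apply: filterS (gap_small _ m0) => t [t0]; rewrite lt_min => /andP[g1 g2].
  have Xt := Xx _ (ltW t0); have Yt := Yy _ (ltW t0).
  have := minX _ Xt; have := minY _ Yt; move: g1 g2; rewrite gapE.
  (* This identity makes the gap the sum of the excesses in [minX] and [minY]. Both are nonnegative,
     so each is at most the gap, hence below its own margin. *)
  have : dot (H *m ys) xs = dot (H^T *m xs) ys by rewrite dotC dot_mulmxr.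
  move=> xy g1 g2 hy hx; split; [apply: h1|apply: h2] => //.
    by rewrite dotNl in hy; rewrite dotNl in hy; lra.
  by rewrite !dotNl in hy *; lra.
exact: cvg_pair_norm.
Unshelve. all: by end_near. Qed.
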